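(* Let $X$ be a finite-dimensional Banach space over $\mathbb{F}$ ($\mathbb{F}=\mathbb{R}$ or $\mathbb{C}$) for which the numerical radius $w(\cdot)$ is a norm on $\mathcal{L}(X)$. Let $\mathcal{V}$ be an $n$-dimensional subspace of $\mathcal{L}(X)_w$ and $T\in\mathcal{L}(X)_w$. Then the following are equivalent. (i) $T\perp_w\mathcal{V}$. (ii) There exist $t_1,t_2,\ldots,t_h>0$ ($h\leq n+1$ if $\mathbb{F}=\mathbb{R}$ and $h\leq 2n+1$ if $\mathbb{F}=\mathbb{C}$), and $x_i^*\in E_{X^*}$, $x_i\in E_X$ for all $1\leq i\leq h$, such that $|x_i^*(x_i)|=1$ and $x_i^*(Tx_i)=w(T)$ for all $1\le i\le h$, $\sum_{i=1}^h t_i=1$, and $\sum_{i=1}^h t_i x_i^*(Sx_i)=0$ for all $S\in\mathcal{V}$. (iii) $0\in co(D_S)$ for all $S\in\mathcal{V}$, where $$D_S=\{x^*(Sx) : x^*\in E_{X^*},\ x\in E_X,\ |x^*(x)|=1,\ x^*(Tx)=w(T)\}.$$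
   Context: For a Banach space $X$ over $\mathbb{F}\in\{\mathbb{R},\mathbb{C}\}$, $X^*$ is its dual and $S_X$ its unit sphere. $E_X$ (resp. $E_{X^*}$) denotes the set of all extreme points of the closed unit ball of $X$ (resp. $X^*$). $\mathcal{L}(X)$ is the space of bounded linear operators on $X$. The numerical radius of $T\in\mathcal{L}(X)$ is $w(T)=\sup\{|x^*(Tx)| : x^*\in S_{X^*},\ x\in S_X,\ x^*(x)=1\}$; only spaces $X$ for which $w(\cdot)$ is a norm on $\mathcal{L}(X)$ are considered. $\mathcal{L}(X)_w$ denotes $\mathcal{L}(X)$ with the norm $w(\cdot)$. For $T,A\in\mathcal{L}(X)_w$, $T\perp_w A$ means $w(T+\lambda A)\geq w(T)$ for all scalars $\lambda\in\mathbb{F}$; for a subspace $\mathcal{V}$, $T\perp_w\mathcal{V}$ means $T\perp_w A$ for all $A\in\mathcal{V}$. $co(\cdot)$ denotes the convex hull. *)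

(* Defs.v *)
From HB Require Import structures.
From mathcomp Require Import all_boot all_order all_algebra.
From mathcomp Require Import complex.
From mathcomp Require Import all_classical all_reals all_analysis.
Set Implicit Arguments.
Unset Strict Implicit.
Unset Printing Implicit Defensive.
Import Order.TTheory GRing.Theory Num.Theory.
Import numFieldNormedType.Exports.

Local Open Scope classical_set_scope.
Local Open Scope ring_scope.

(* In R[i], as in every numFieldType, x <= y means that y - x is a nonnegative
   real, and norms take values in the scalar field.  Every inequality below
   between scalars therefore compares real numbers, for both choices of field. *)
Inductive scalar_kind := RealScalars | ComplexScalars.

Definition scalar_field (R : realType) (k : scalar_kind) : numFieldType :=
  match k with
  | RealScalars => R
  | ComplexScalars => R[i]
  end.

Definition caratheodory_bound (k : scalar_kind) (n : nat) : nat :=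
  match k with
  | RealScalars => n + 1
  | ComplexScalars => 2 * n + 1
  end.

#[short(type="finDimBanachType")]
HB.structure Definition FinDimBanach (K : numFieldType) :=
  {X of CompleteNormedModule K X & Vector K X}.

Section Convexity.
Context {K : numFieldType} {V : lmodType K}.

Definition is_norm (N : V -> K) : Prop :=
  [/\ forall v, 0 <= N v,
      forall v, N v = 0 -> v = 0,
      forall a v, N (a *: v) = `|a| * N v
    & forall u v, N (u + v) <= N u + N v].

Definition closed_unit_ball (N : V -> K) : set V := [set v | N v <= 1].

Definition extreme_points (C : set V) : set V :=
  [set v | C v /\ forall (a b : V) (t : K), C a -> C b -> 0 < t < 1 ->
                  v = t *: a + (1 - t) *: b -> a = v /\ b = v].

Definition convex_hull (A : set V) : set V :=
  [set v | exists (m : nat) (t : 'I_m -> K) (a : 'I_m -> V),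
    [/\ forall i, 0 <= t i, forall i, A (a i), \sum_i t i = 1
      & v = \sum_i t i *: a i]].

End Convexity.

Section NumericalRadius.
Context {K : numFieldType} {X : finDimBanachType K}.

(* As X is finite-dimensional, every linear functional and every linear operator
   on X is bounded: 'Hom(X, K^o) is the dual of X and 'End(X) is L(X). *)
Definition dual_norm (f : 'Hom(X, K^o)) : K :=
  supremum 0 [set `|f x : K| | x in [set x : X | `|x| <= 1]].

Definition extX : set X := extreme_points (closed_unit_ball (fun x => `|x|)).

Definition extdual : set 'Hom(X, K^o) :=
  extreme_points (closed_unit_ball dual_norm).

Definition numerical_radius (T : 'End(X)) : K :=
  supremum 0 [set r : K | exists (f : 'Hom(X, K^o)) (x : X),
    [/\ dual_norm f = 1, `|x| = 1, f x = 1 & r = `|f (T x) : K|]].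

Definition orth_w (T A : 'End(X)) : Prop :=
  forall lambda : K, numerical_radius T <= numerical_radius (T + lambda *: A).

Definition orth_w_space (T : 'End(X)) (W : {vspace 'End(X)}) : Prop :=
  forall A, A \in W -> orth_w T A.

Definition attaining_values (T S : 'End(X)) : set K^o :=
  [set z | exists (f : 'Hom(X, K^o)) (x : X),
    [/\ extdual f, extX x, `|f x : K| = 1, f (T x) = numerical_radius T
      & z = f (S x)]].

End NumericalRadius.

(* Main.v *)
(* Call a pair (f, x) of norm-one elements of X* and X with |f(x)| = 1 a state.
   In finite dimension the states form a compact set and w(A) is the maximum of
   Re f(Ax) over it.  If T is orthogonal to V, comparing w(T - eS) with w(T) for
   small e > 0 yields, for each S in V, a state with f(Tx) = w(T) and
   Re f(Sx) <= 0.  By separation, 0 is then a convex combination of the vectors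
   (Re f(S_j x))_j, where (S_j) is a real basis of V and (f, x) ranges over the
   states attaining w(T).  The attaining states are cut out by linear
   functionals reaching their maximum, so decomposing x and then f by Minkowski's
   theorem replaces them by pairs of extreme points, and Caratheodory's theorem
   in R^(dim_R V) bounds their number.  Both scalar fields are treated at once
   through real_form, whose parameter d is the dimension of the field over R. *)
Require Import Defs.
From HB Require Import structures.
From mathcomp Require Import all_boot all_order all_algebra.
From mathcomp Require Import complex.
From mathcomp Require Import all_classical all_reals all_analysis.
From mathcomp Require Import ring lra.
Import Order.TTheory GRing.Theory Num.Theory.
Import numFieldNormedType.Exports.

Local Open Scope classical_set_scope.
Local Open Scope ring_scope.

Set Implicit Arguments.
Unset Strict Implicit.
Unset Printing Implicit Defensive.

(** * Caratheodory's theorem *)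

Section Caratheodory.
Context {R : realFieldType} {T : Type} {N : nat}.
Variables (A : set T) (phi : T -> 'rV[R]_N).

(** The points are kept in [T] and sent to vectors by [phi], so that the pairs behind the vectors
    are not lost. Weights may vanish, which lets short combinations be padded to length [h]. *)
Definition combination (h : nat) (v : 'rV[R]_N) : Prop :=
  exists (t : 'I_h -> R) (p : 'I_h -> T),
    [/\ forall i, 0 <= t i, forall i, A (p i), \sum_i t i = 1
      & \sum_i t i *: phi (p i) = v].

(** The rows [(1, a i)] live in dimension [N.+1 < h], hence are linearly dependent; the constant
    column records the sum of the coefficients. A nonzero family of sum zero has a positive term. *)
Lemma affine_dependence (h : nat) (a : 'I_h -> 'rV[R]_N) : (N.+1 < h)%N ->
  exists l : 'I_h -> R,
    [/\ \sum_i l i = 0, \sum_i l i *: a i = 0 & exists i, 0 < l i].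
Proof.
move=> ltNh.
pose B : 'M[R]_(h, 1 + N) := row_mx (const_mx 1) (\matrix_(i, j) a i 0 j).
have kerB0 : kermx B != 0.
  by rewrite kermx_eq0 /row_free; apply/negP => /eqP rB; move: (rank_leq_col B);
    rewrite rB leqNgt ltNh.
have [u uB0 u0] : exists2 u : 'rV_h, u *m B = 0 & u != 0.
  have /rowV0Pn[u /sub_kermxP uB u0] := kerB0.
  by exists u.
have [s1 s2] : \sum_i u 0 i = 0 /\ \sum_i u 0 i *: a i = 0.
  move: uB0; rewrite mul_mx_row -row_mx0 => /eq_row_mx[e1 e2]; split.
    move/matrixP/(_ 0 0): e1; rewrite !mxE; apply: etrans.
    by apply: eq_bigr => i _; rewrite mxE mulr1.
  apply/rowP => j; move/rowP/(_ j): e2; rewrite !mxE summxE; apply: etrans.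
  by apply: eq_bigr => i _; rewrite !mxE.
exists (u 0); split => //.
apply: contrapT => noPos; move/eqP: u0; apply; apply/rowP => i; rewrite mxE.
have le0 j : u 0 j <= 0 by rewrite leNgt; apply/negP => ?; apply: noPos; exists j.
apply/eqP; rewrite -oppr_eq0; apply/eqP.
have /psumr_eq0P -> // : \sum_(j < h) - u 0 j = 0 by rewrite sumrN s1 oppr0.
by move=> j _; rewrite oppr_ge0.
Qed.

(** Subtract the largest multiple of an affine dependence that keeps all weights nonnegative: the
    index minimizing [t i / l i] among those with [0 < l i] loses its weight. *)
Lemma combination_drop (h : nat) (v : 'rV[R]_N) :
  (N < h)%N -> combination h.+1 v -> combination h v.
Proof.
move=> ltNh [t [p [t0 Ap t1 tv]]].
have [l [l0 la0 [i0 li0]]] := @affine_dependence h.+1 (phi \o p) ltNh.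
pose q i := t i / l i.
have [k lk mink] := @arg_minP _ _ _ i0 (fun i => 0 < l i) q li0.
pose t' i := t i - q k * l i.
have t'0 i : 0 <= t' i.
  rewrite subr_ge0; have [li|li] := ltP 0 (l i).
    by rewrite -ler_pdivlMr //; exact: mink.
  by rewrite (le_trans _ (t0 i)) // mulr_ge0_le0 // divr_ge0 // ltW.
have t'k : t' k = 0 by rewrite /t' /q divfK ?subrr // gt_eqF.
have s1 : \sum_i t' i = 1 by rewrite sumrB -mulr_sumr l0 mulr0 subr0.
have s2 : \sum_i t' i *: phi (p i) = v.
  under eq_bigr do rewrite scalerBl -scalerA.
  by rewrite sumrB -scaler_sumr la0 scaler0 subr0.
exists (t' \o lift k), (p \o lift k); split => //=.
- by move: s1; rewrite (bigD1_ord k) //= t'k add0r.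
- by move: s2; rewrite (bigD1_ord k) //= t'k scale0r add0r.
Qed.

Lemma combination_reduce (h k : nat) (v : 'rV[R]_N) :
  (N < k)%N -> (k <= h)%N -> combination h v -> combination k v.
Proof.
move=> ltNk /subnK <-; elim: (h - k)%N => // m IH.
rewrite addSn => /combination_drop c; apply: IH; apply: c.
by rewrite (leq_trans ltNk) // leq_addl.
Qed.

Lemma combination_mix (h : nat) (s : R) (u v : 'rV[R]_N) : 0 <= s <= 1 ->
  forall k, combination h u -> combination k v ->
  combination (h + k) (s *: u + (1 - s) *: v).
Proof.
move=> /andP[s0 s1] k [t [p [t0 Ap t1 <-]]] [t' [p' [t'0 Ap' t'1 <-]]].
pose tt i := match fintype.split i with inl i => s * t i | inr i => (1 - s) * t' i end.
pose pp i := match fintype.split i with inl i => p i | inr i => p' i end.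
have ttl i : tt (lshift k i) = s * t i by rewrite /tt (unsplitK (inl i)).
have ttr i : tt (rshift h i) = (1 - s) * t' i by rewrite /tt (unsplitK (inr i)).
have ppl i : pp (lshift k i) = p i by rewrite /pp (unsplitK (inl i)).
have ppr i : pp (rshift h i) = p' i by rewrite /pp (unsplitK (inr i)).
exists tt, pp; split.
- by move=> i; rewrite /tt; case: fintype.split => j; rewrite mulr_ge0 // subr_ge0.
- by move=> i; rewrite /pp; case: fintype.split => j.
- rewrite big_split_ord /=; under eq_bigr do rewrite ttl.
  under [X in _ + X = _]eq_bigr do rewrite ttr.
  by rewrite -!mulr_sumr t1 t'1 !mulr1 addrC subrK.
- rewrite big_split_ord /=; under eq_bigr do rewrite ttl ppl -scalerA.
  under [X in _ + X = _]eq_bigr do rewrite ttr ppr -scalerA.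
  by rewrite -!scaler_sumr.
Qed.

(** Mixing doubles the number of points, and Caratheodory's reduction brings it back to [N.+1]. *)
Lemma combination_convex (s : R) (u v : 'rV[R]_N) : 0 <= s <= 1 ->
  combination N.+1 u -> combination N.+1 v ->
  combination N.+1 (s *: u + (1 - s) *: v).
Proof.
move=> s01 cu cv; apply: (@combination_reduce (N.+1 + N.+1)) => //.
  exact: leq_addr.
exact: combination_mix.
Qed.

Lemma combination_point (h : nat) (a : T) : A a -> combination h.+1 (phi a).
Proof.
move=> Aa; exists (fun i => (i == ord0)%:R), (fun=> a); split => //.
- by rewrite (bigD1 ord0) //= big1 ?addr0 // => i /negbTE->.
- by rewrite -scaler_suml (bigD1 ord0) //= big1 ?addr0 ?scale1r // => i /negbTE->.
Qed.

Lemma combination_pos (h : nat) (v : 'rV[R]_N) : combination h v ->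
  exists (k : nat) (t : 'I_k -> R) (p : 'I_k -> T),
    [/\ (k <= h)%N, forall i, 0 < t i, forall i, A (p i), \sum_i t i = 1
      & \sum_i t i *: phi (p i) = v].
Proof.
move=> [t [p [t0 Ap t1 tv]]]; pose D := [pred i | t i != 0].
have drop (U : zmodType) (F : 'I_h -> U) : (forall i, t i = 0 -> F i = 0) ->
    \sum_i F i = \sum_(i < #|D|) F (enum_val i).
  move=> F0; rewrite -big_enum_val (bigID D) /= [X in _ + X]big1 ?addr0 //.
  by move=> i; rewrite negbK => /eqP /F0.
exists #|D|, (t \o enum_val), (p \o enum_val); split => //=.
- by rewrite -[leqRHS]card_ord max_card.
- by move=> i; rewrite lt0r t0 andbT; exact: (enum_valP i).
- by rewrite -t1 (drop _ t).
- by rewrite -tv (drop _ (fun i => t i *: phi (p i))) // => i ->; rewrite scale0r.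
Qed.

End Caratheodory.

(** * Compactness and separation *)

Section ContinuousRealFunctions.
Context {R : realType} {T : topologicalType}.

Lemma continuous_sumr (I : finType) (F : I -> T -> R) :
  (forall i, continuous (F i)) -> continuous (fun x => \sum_i F i x).
Proof. by move=> cF; apply: continuous_big => //; exact: add_continuous. Qed.

Lemma continuous_mulr (f g : T -> R) :
  continuous f -> continuous g -> continuous (fun x => f x * g x).
Proof. by move=> cf cg x; apply: cvgM; [exact: cf|exact: cg]. Qed.

Lemma closed_sublevel (f : T -> R) (c : R) :
  continuous f -> closed [set x | f x <= c].
Proof.
by move=> cf; apply: (preimage_closed (D := [set y | y <= c]));
  [move=> ? _; exact: cf|exact: closed_le].
Qed.

Lemma closed_suplevel (f : T -> R) (c : R) :
  continuous f -> closed [set x | c <= f x].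
Proof.
by move=> cf; apply: (preimage_closed (D := [set y | c <= y]));
  [move=> ? _; exact: cf|exact: closed_ge].
Qed.

Lemma compact_argmin (f : T -> R) (A : set T) : A !=set0 -> compact A ->
  continuous f -> exists2 c, A c & forall x, A x -> f c <= f x.
Proof.
move=> A0 cA cf.
have [c /[!inE] Ac minc] := compact_EVT_min A0 cA (continuous_subspaceT cf).
by exists c => // x Ax; apply: minc; rewrite inE.
Qed.

Lemma compact_argmax (f : T -> R) (A : set T) : A !=set0 -> compact A ->
  continuous f -> exists2 c, A c & forall x, A x -> f x <= f c.
Proof.
move=> A0 cA cf.
have [c /[!inE] Ac maxc] := compact_EVT_max A0 cA (continuous_subspaceT cf).
by exists c => // x Ax; apply: maxc; rewrite inE.
Qed.

End ContinuousRealFunctions.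

Section Separation.
Context {R : realType} {T : topologicalType} {N : nat}.
Variables (M : set T) (g : T -> 'rV[R]_N).
Hypotheses (M0 : M !=set0) (cM : compact M).
Hypothesis g_continuous : forall j, continuous (fun x => g x 0 j).

(** Since [N.+1] points suffice, the convex hull of the image of [M] is the continuous image of a
    closed part of a product of [N.+1] copies of [[0, 1] * M], compact by Tychonoff. *)
Let weighted := prod_topology (fun _ : 'I_N.+1 => (R * T)%type).

Let barycenter (q : weighted) : 'rV[R]_N := \sum_i (q i).1 *: g (q i).2.

Let weighted_points : set weighted :=
  [set q | forall i, (`[0, 1]%classic `*` M) (q i)] `&`
  ([set q | \sum_i (q i).1 <= 1] `&` [set q | 1 <= \sum_i (q i).1]).

Let weight_continuous i : continuous (fun q : weighted => (q i).1).
Proof.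
move=> q; apply: (@continuous_comp weighted _ _ (proj i) fst).
  exact: proj_continuous.
exact: cvg_fst.
Qed.

Let point_continuous i j : continuous (fun q : weighted => g (q i).2 0 j).
Proof.
move=> q; apply: (@continuous_comp weighted _ _ (fun q => (q i).2) (fun x => g x 0 j)).
  apply: (@continuous_comp weighted _ _ (proj i) snd); first exact: proj_continuous.
  exact: cvg_snd.
exact: g_continuous.
Qed.

Let weighted_compact : compact weighted_points.
Proof.
have cw : continuous (fun q : weighted => \sum_i (q i).1).
  by apply: continuous_sumr => i; exact: weight_continuous.
apply: compact_closedI.
  apply: (@tychonoff 'I_N.+1 (fun=> (R * T)%type) (fun=> `[0, 1]%classic `*` M)) => _.
  by apply: compact_setX => //; exact: segment_compact.
by apply: closedI; [exact: closed_sublevel|exact: closed_suplevel].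
Qed.

Lemma combination_weighted (v : 'rV[R]_N) :
  combination M g N.+1 v <-> exists2 q, weighted_points q & barycenter q = v.
Proof.
split=> [[t [p [t0 Mp t1 tv]]]|[q [/= Mq [q1 q2]] qv]].
  exists (fun i => (t i, p i)) => //; split => /=; last by rewrite t1.
  move=> i; split => //=; rewrite in_itv /= t0 /= -t1 (bigD1 i) //= lerDl.
  by rewrite sumr_ge0.
exists (fun i => (q i).1), (fun i => (q i).2); split => //.
- by move=> i; have [] := Mq i; rewrite /= in_itv /= => /andP[].
- by move=> i; have [] := Mq i.
- by apply/eqP; rewrite eq_le q1 q2.
Qed.

(* Let p be the barycenter of least norm.  If p <> 0, moving from p towards a
   point g m with <p, g m> <= 0 would decrease the norm. *)
Lemma zero_combination :
  (forall l : 'rV[R]_N, exists2 m, M m & \sum_j l 0 j * g m 0 j <= 0) ->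
  combination M g N.+1 0.
Proof.
move=> sepM.
pose sq (v : 'rV[R]_N) := \sum_j v 0 j * v 0 j.
have sqc : continuous (sq \o barycenter).
  have cb j : continuous (fun q => barycenter q 0 j).
    have -> : (fun q => barycenter q 0 j) = (fun q => \sum_i (q i).1 * g (q i).2 0 j).
      by apply/funext => q; rewrite /barycenter summxE; apply: eq_bigr => i _; rewrite mxE.
    apply: continuous_sumr => i; apply: continuous_mulr.
      exact: weight_continuous.
    exact: point_continuous.
  by apply: continuous_sumr => j; apply: continuous_mulr; exact: cb.
have W0 : weighted_points !=set0.
  have [m Mm] := M0.
  by have [q Wq _] := (combination_weighted (g m)).1 (combination_point g N Mm); exists q.
have [q Wq minq] := compact_argmin W0 weighted_compact sqc.
have cq : combination M g N.+1 (barycenter q) by apply/combination_weighted; exists q.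
have {}minq x : weighted_points x -> sq (barycenter q) <= sq (barycenter x).
  exact: minq.
move: (barycenter q) cq minq => p cp minp.
have {}minp v : combination M g N.+1 v -> sq p <= sq v.
  by move=> /combination_weighted[q' Wq' <-]; exact: minp.
suff sqp0 : sq p = 0.
  suff <- : p = 0 by [].
  apply/rowP => j; rewrite mxE; apply/eqP.
  have /psumr_eq0P/(_ j isT)/eqP := sqp0; rewrite mulf_eq0 orbb; apply => // i _.
  by rewrite -expr2 sqr_ge0.
have sq0 v : 0 <= sq v by apply: sumr_ge0 => j _; rewrite -expr2 sqr_ge0.
have [m Mm pm] := sepM p.
apply/eqP; rewrite eq_le sq0 andbT leNgt; apply/negP => sqp.
pose a := sq p; pose b := sq (g m); pose c := \sum_j p 0 j * g m 0 j.
(* As the cross term [c] is nonpositive, the squared norm after a move by [e] is at most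
   [(1 - e)^2 a + e^2 b]. This [e] minimizes that bound, with value [a - e a < a]. *)
pose e := a / (a + b).
have b0 : 0 <= b := sq0 _.
have ab0 : 0 < a + b by apply: ltr_pwDl.
have e01 : 0 <= 1 - e <= 1.
  have -> : 1 - e = b / (a + b).
    rewrite /e -[X in X - _](@divff _ (a + b)) ?gt_eqF // -mulrBl.
    by rewrite [a + b]addrC addrK.
  by rewrite divr_ge0 ?(ltW ab0) //= ler_pdivrMr // mul1r lerDr (ltW sqp).
have := minp _ (combination_convex e01 cp (combination_point g N Mm)).
have -> : sq ((1 - e) *: p + (1 - (1 - e)) *: g m) =
    (1 - e) ^+ 2 * a + (e * (1 - e) * c *+ 2) + e ^+ 2 * b.
  rewrite /sq /a /b /c !mulr_sumr -sumrMnl -!big_split /=; apply: eq_bigr => j _.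
  by rewrite !mxE; ring.
have e0 : 0 < e by rewrite divr_gt0.
have ce : e * (1 - e) * c <= 0.
  by rewrite mulr_ge0_le0 // mulr_ge0 ?(ltW e0) //; have /andP[] := e01.
have eab : e * (a + b) = a by rewrite divfK // gt_eqF.
have e2 : e ^+ 2 * b = e * a - e ^+ 2 * a by rewrite -[X in e * X]eab; ring.
have ea : 0 < e * a by rewrite mulr_gt0.
by rewrite e2 -/a mulr2n => le_a; lra.
Qed.

End Separation.

(** * Real structure of the scalar field *)

(* The scalar field [K] seen as a [d]-dimensional real vector space, with a
   real part through which real inequalities are read off. *)
Record real_form (R : realType) (K : numFieldType) (d : nat) := RealForm {
  inR : {rmorphism R -> K};
  re : {additive K -> R};
  rbasis : 'I_d -> K;
  re_inRM : forall a z, re (inR a * z) = a * re z;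
  re1 : re 1 = 1;
  inR_ge0 : forall a, (0 <= inR a) = (0 <= a);
  inR_re : forall z, 0 <= z -> inR (re z) = z;
  re_le_norm : forall z, re z <= re `|z|;
  re_eq_norm : forall z, re z = re `|z| -> z = `|z|;
  rbasis_span : forall z, exists r : 'I_d -> R, z = \sum_l inR (r l) * rbasis l;
  rbasis_free : forall r : 'I_d -> R,
    \sum_l inR (r l) * rbasis l = 0 -> forall l, r l = 0
}.

Section RealForm.
Context {R : realType} {K : numFieldType} {d : nat} (S : real_form R K d).
Notation inR := (inR S).
Notation re := (re S).
Notation e_ := (rbasis S).

Lemma re_ge0 z : 0 <= z -> 0 <= re z.
Proof. by move=> z0; rewrite -(inR_ge0 S) inR_re. Qed.

Lemma re_le y z : y <= z -> re y <= re z.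
Proof. by rewrite -subr_ge0 => /re_ge0; rewrite raddfB subr_ge0. Qed.

Lemma inR_le a b : (inR a <= inR b) = (a <= b).
Proof. by rewrite -subr_ge0 -rmorphB inR_ge0 subr_ge0. Qed.

Lemma inR_lt a b : (inR a < inR b) = (a < b).
Proof. by rewrite !lt_neqAle inR_le (inj_eq (fmorph_inj _)). Qed.

Lemma le_re_le y z : 0 <= y -> 0 <= z -> (re y <= re z) = (y <= z).
Proof. by move=> y0 z0; rewrite -inR_le !inR_re. Qed.

Lemma norm_inR a : `|inR a| = inR `|a|.
Proof.
have [a0|/ltW a0] := leP 0 a; first by rewrite !ger0_norm // inR_ge0.
by rewrite !ler0_norm ?rmorphN // -oppr_ge0 -rmorphN inR_ge0 oppr_ge0.
Qed.

(** If [z] were nonzero, expanding [z^-1] on the basis would give [re (z^-1 * z) = 0], against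
    [re 1 = 1]. *)
Lemma rbasis_separates z : (forall l, re (e_ l * z) = 0) -> z = 0.
Proof.
move=> ez; apply: contrapT => /eqP z0.
have [r zr] := rbasis_span S z^-1.
have : re (z^-1 * z) = 0.
  rewrite zr mulr_suml raddf_sum /= big1 // => l _.
  by rewrite -mulrA re_inRM ez mulr0.
by rewrite mulVf // re1 => /eqP; rewrite oner_eq0.
Qed.

Lemma phase z : exists2 c : K, `|c| = 1 & c * z = `|z|.
Proof.
have [->|z0] := eqVneq z 0; first by exists 1; rewrite ?normr1 // mulr0 normr0.
exists (`|z| / z); last by rewrite divfK.
by rewrite normrM normfV normr_id divff // normr_eq0.
Qed.

Lemma norm_sumZ {V : lmodType K} (N : V -> K) (I : finType) (v : I -> V) :
  is_norm N -> N (\sum_i v i) <= \sum_i N (v i).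
Proof.
move=> [_ _ NZ ND]; apply: (big_ind2 (fun a b => N a <= b)) => //.
  by rewrite -(scale0r (0 : V)) NZ normr0 mul0r.
by move=> x1 x2 y1 y2 h1 h2; rewrite (le_trans (ND _ _)) // lerD.
Qed.

Section Norm.
Context {V : lmodType K} (N : V -> K) (Nnorm : is_norm N).

Lemma is_norm_ge0 v : 0 <= N v. Proof. by case: Nnorm. Qed.
Lemma is_norm_eq0 v : N v = 0 -> v = 0. Proof. by case: Nnorm => _ + _ _; apply. Qed.
Lemma is_normZ a v : N (a *: v) = `|a| * N v. Proof. by case: Nnorm. Qed.
Lemma is_normD u v : N (u + v) <= N u + N v. Proof. by case: Nnorm. Qed.

Lemma re_norm_dist u v : `|re (N u) - re (N v)| <= re (N (u - v)).
Proof.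
rewrite ler_norml; apply/andP; split; last first.
  by rewrite lerBlDr -raddfD /= re_le // -{1}[u](subrK v) is_normD.
rewrite lerNl opprB lerBlDr -raddfD /= re_le //.
have -> : N (u - v) = N (v - u).
  by rewrite -(opprB v u) -[in LHS](scaleN1r (v - u)) is_normZ normrN1 mul1r.
by rewrite -{1}[v](subrK u) is_normD.
Qed.

(** [N] is an abstract norm with no topology attached, so continuity comes from squeezing: by the
    reverse triangle inequality the variation is at most [h y], which tends to 0. *)
Lemma continuous_norm_comb (T : topologicalType) (I : finType)
    (g : I -> T -> R) (v : I -> V) :
  (forall i, continuous (g i)) ->
  continuous (fun x => re (N (\sum_i inR (g i x) *: v i))).
Proof.
move=> cg x.
pose c := re (N (\sum_i inR (g i x) *: v i)).
pose h y := \sum_i `|g i x - g i y| * re (N (v i)).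
have ch : continuous h.
  apply: continuous_sumr => i; apply: continuous_mulr; last exact: cst_continuous.
  move=> y; apply: cvg_norm; apply: cvgB; [exact: cvg_cst|exact: cg].
have hx : h x = 0 by rewrite /h big1 // => i _; rewrite subrr normr0 mul0r.
apply: (@squeeze_cvgr _ _ _ _ (fun y => c - h y) (fun y => c + h y)).
- apply: nearW => y; rewrite -ler_distlC (le_trans (re_norm_dist _ _)) //.
  rewrite -sumrB; under eq_bigr do rewrite -scalerBl -rmorphB.
  apply: le_trans (re_le (norm_sumZ _ Nnorm)) _.
  rewrite raddf_sum /=; apply: ler_sum => i _.
  by rewrite is_normZ norm_inR re_inRM.
- rewrite -[X in _ --> X]subr0 -[in X in _ --> X]hx.
  by apply: cvgB; [exact: cvg_cst|exact: ch].
- rewrite -[X in _ --> X]addr0 -[in X in _ --> X]hx.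
  by apply: cvgD; [exact: cvg_cst|exact: ch].
Qed.

End Norm.
End RealForm.

(** * Real coordinates on a finite-dimensional space *)

(** Take a subspace of maximal dimension among those inside [P]; adjoining any vector of [P] cannot
    enlarge it. *)
Lemma vspace_of_closed {F : fieldType} {vT : vectType F} (P : vT -> Prop) :
  P 0 -> (forall a u v, P u -> P v -> P (a *: u + v)) ->
  exists U : {vspace vT}, forall v, v \in U <-> P v.
Proof.
move=> P0 Plin.
pose dims n := `[< exists U : {vspace vT}, (forall v, v \in U -> P v) /\ \dim U = n >].
have ex_dims : exists n, dims n.
  exists 0%N; apply/asboolP; exists 0%VS; rewrite dimv0; split => // v.
  by rewrite memv0 => /eqP->.
have dims_le n : dims n -> (n <= \dim {:vT})%N.
  by move=> /asboolP[U [_ <-]]; exact: dimvS (subvf U).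
case: (ex_maxnP ex_dims dims_le) => _ /asboolP[U [PU <-]] maxU.
exists U => v; split; first exact: PU.
move=> Pv; suff : (U + <[v]> <= U)%VS by rewrite subv_add => /andP[_]; rewrite -memvE.
have UUv := addvSl U <[v]>.
suff /eqP <- : U == (U + <[v]>)%VS by [].
rewrite eqEdim UUv maxU //; apply/asboolP; exists (U + <[v]>)%VS; split => // w.
move=> /memv_addP[u Uu [w' /vlineP[a ->] ->]].
by rewrite addrC; apply: Plin => //; exact: PU.
Qed.

Section RealCoordinates.
Context {R : realType} {K : numFieldType} {d : nat} (S : real_form R K d).
Context {W : vectType K}.
Notation inR := (inR S).
Notation re := (re S).
Notation e_ := (rbasis S).

Lemma real_span (U : {vspace W}) : exists E : 'I_(\dim U * d) -> W,
  [/\ forall k, E k \in U,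
      forall w, w \in U -> exists r : 'rV[R]__, w = \sum_k inR (r 0 k) *: E k
    & forall r : 'rV[R]__, \sum_k inR (r 0 k) *: E k = 0 -> r = 0].
Proof.
pose b := vbasis U.
pose pr (k : 'I_(\dim U * d)) := enum_val (cast_ord (esym (mxvec_cast _ _)) k).
pose E k := e_ (pr k).2 *: b`_(pr k).1.
have prE i l : pr (mxvec_index i l) = (i, l).
  by rewrite /pr /mxvec_index cast_ordK enum_rankK.
have sumE (r : 'rV[R]__) : \sum_k inR (r 0 k) *: E k =
    \sum_(i < \dim U) (\sum_(l < d) inR (vec_mx r i l) * e_ l) *: b`_i.
  pose F i l := inR (r 0 (mxvec_index i l)) *: E (mxvec_index i l).
  transitivity (\sum_(p : 'I_(\dim U) * 'I_d) F p.1 p.2).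
    by rewrite (reindex _ (curry_mxvec_bij _ _)) /=; apply: eq_bigr => -[].
  rewrite -(pair_bigA _ F) /F /=.
  apply: eq_bigr => i _; rewrite scaler_suml; apply: eq_bigr => l _.
  by rewrite /E prE /= scalerA mxE.
exists E; split.
- by move=> k; rewrite memvZ // vbasis_mem // mem_nth // size_tuple.
- move=> w /coord_vbasis wE.
  have [r rE] := choice (fun i => rbasis_span S (coord b i w)).
  exists (mxvec (\matrix_(i, l) r i l)); rewrite sumE {1}wE mxvecK.
  by apply: eq_bigr => i _; rewrite rE; congr (_ *: _); apply: eq_bigr => l _; rewrite mxE.
- move=> r; rewrite sumE => r0.
  have /freeP/(_ _ r0) c0 := basis_free (vbasisP U).
  rewrite -[r]vec_mxK; apply/eqP; rewrite mxvec_eq0; apply/eqP/matrixP => i l.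
  by rewrite [RHS]mxE; exact: (rbasis_free (c0 i)).
Qed.

Section UnitBall.
Variables (N : W -> K) (Nnorm : is_norm N).
Context {D : nat} (E : 'I_D -> W).
Hypothesis E_free : forall r : 'rV[R]_D, \sum_k inR (r 0 k) *: E k = 0 -> r = 0.
Notation vec := (fun r : 'rV[R]_D => \sum_k inR (r 0 k) *: E k).

Let norm1 (r : 'rV[R]_D) : R := \sum_k `|r 0 k|.

Let norm1_ge k (r : 'rV[R]_D) : `|r 0 k| <= norm1 r.
Proof. by rewrite /norm1 (bigD1 k) //= lerDl sumr_ge0. Qed.

Let box_compact (c : R) (A : set 'rV[R]_D) : closed A ->
  (forall (r : 'rV[R]_D) k, A r -> `|r 0 k| <= c) -> compact A.
Proof.
move=> Acl Abnd.
have := @rV_compact R D (fun=> `[- c, c]%classic) (fun=> @segment_compact _ _ _).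
move/subclosed_compact; apply => // r Ar k.
by rewrite /= in_itv /= -ler_norml; exact: Abnd.
Qed.

Let norm1_continuous : continuous norm1.
Proof.
apply: continuous_sumr => k r.
apply: (@continuous_comp _ _ _ (fun r : 'rV[R]_D => r 0 k) Num.norm).
  exact: coord_continuous.
exact: norm_continuous.
Qed.

Lemma norm_vec_continuous : continuous (fun r : 'rV[R]_D => re (N (vec r))).
Proof.
apply: (@continuous_norm_comb _ _ _ S _ _ Nnorm 'rV[R]_D _ (fun k r => r 0 k) E) => k.
exact: coord_continuous.
Qed.

Let vecZ a (r : 'rV[R]_D) : vec (a *: r) = inR a *: vec r.
Proof.
by rewrite scaler_sumr; apply: eq_bigr => k _; rewrite mxE rmorphM scalerA.
Qed.

Let norm1Z a (r : 'rV[R]_D) : norm1 (a *: r) = `|a| * norm1 r.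
Proof. by rewrite /norm1 mulr_sumr; apply: eq_bigr => k _; rewrite mxE normrM. Qed.

(** Equivalence of norms: [c] is the minimum of the norm on the compact unit sphere of [norm1],
    positive by freeness of [E], and homogeneity does the rest. *)
Lemma coord_bound : exists2 c : R, 0 < c & forall r : 'rV[R]_D, c * norm1 r <= re (N (vec r)).
Proof.
pose sphere := [set r | norm1 r <= 1] `&` [set r | 1 <= norm1 r].
have csphere : compact sphere.
  apply: (@box_compact 1).
    by apply: closedI; [exact: closed_sublevel|exact: closed_suplevel].
  by move=> r k [/= r1 _]; rewrite (le_trans (norm1_ge _ _)).
have unit r : norm1 r != 0 -> sphere ((norm1 r)^-1 *: r).
  move=> r0; rewrite /sphere /= norm1Z ger0_norm ?invr_ge0 ?sumr_ge0 //.
  by rewrite mulVf.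
have N0 r : 0 <= re (N (vec r)) by rewrite re_ge0 // is_norm_ge0.
(* The sphere is empty when [D = 0]; then [norm1] vanishes identically and any constant works. *)
have [sphere0|/asboolPn sphere0] := pselect (sphere !=set0); last first.
  exists 1 => // r; rewrite mul1r; have [-> //|/unit ur] := eqVneq (norm1 r) 0.
  by move/asboolPn: sphere0 => /(_ (ex_intro _ _ ur)).
have [r0 [/= r01 r10] minr0] := compact_argmin sphere0 csphere norm_vec_continuous.
have pos : 0 < re (N (vec r0)).
  rewrite lt0r N0 andbT; apply/eqP => reN0.
  have : vec r0 = 0.
    apply: (is_norm_eq0 Nnorm).
    by rewrite -[LHS](inR_re S (is_norm_ge0 Nnorm _)) reN0 rmorph0.
  move/E_free => r00; move: r10; rewrite r00 /norm1 big1 ?ler10 // => k _.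
  by rewrite mxE normr0.
exists (re (N (vec r0))) => // r.
have [-> |rn0] := eqVneq (norm1 r) 0; first by rewrite mulr0.
have rp : 0 < norm1 r by rewrite lt0r rn0 sumr_ge0.
have := minr0 _ (unit _ rn0); rewrite vecZ (is_normZ Nnorm) norm_inR re_inRM.
rewrite ger0_norm ?invr_ge0 ?(ltW rp) // [_^-1 * _]mulrC.
by rewrite ler_pdivlMr.
Qed.

Lemma unit_ball_compact : compact [set r : 'rV[R]_D | N (vec r) <= 1].
Proof.
have [c c0 cN] := coord_bound.
have -> : [set r : 'rV[R]_D | N (vec r) <= 1] = [set r : 'rV[R]_D | re (N (vec r)) <= 1].
  apply/funext => r /=.
  by rewrite -(le_re_le S (is_norm_ge0 Nnorm _) ler01) re1.
apply: (@box_compact c^-1); first exact/closed_sublevel/norm_vec_continuous.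
move=> r k /= r1; rewrite (le_trans (norm1_ge _ _)) // -[c^-1]mulr1 ler_pdivlMl //.
exact: le_trans r1.
Qed.

End UnitBall.
End RealCoordinates.

(** * Minkowski's theorem *)

Section Minkowski.
Context {R : realType} {K : numFieldType} {d : nat} (S : real_form R K d).
Context {W : vectType K} (N : W -> K) (Nnorm : is_norm N).
Notation inR := (inR S).
Notation re := (re S).

Let ball : set W := closed_unit_ball N.

Lemma unit_ball_convex (a b : W) (t : R) : 0 <= t <= 1 -> ball a -> ball b ->
  ball (inR t *: a + (1 - inR t) *: b).
Proof.
rewrite /ball /closed_unit_ball /= => /andP[t0 t1] Na Nb.
rewrite (le_trans (is_normD Nnorm _ _)) // !(is_normZ Nnorm).
have t0' : 0 <= inR t by rewrite inR_ge0.
have t1' : 0 <= 1 - inR t by rewrite -(rmorph1 inR) -rmorphB inR_ge0 subr_ge0.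
rewrite !ger0_norm // -[leRHS](subrK (inR t)) addrC.
by rewrite lerD // ler_piMr.
Qed.

(** At a point [v] of the ball these [w] form a real subspace, the direction of the smallest face
    containing [v]; its dimension drives the induction below. *)
Let direction (v w : W) :=
  exists2 e : R, 0 < e & ball (v + inR e *: w) /\ ball (v - inR e *: w).

Let ball_between (v w : W) (s e : R) :
  0 <= s <= e -> 0 < e -> ball v -> ball (v + inR e *: w) -> ball (v + inR s *: w).
Proof.
move=> /andP[s0 se] e0 bv be.
have -> : v + inR s *: w = inR (s / e) *: (v + inR e *: w) + (1 - inR (s / e)) *: v.
  rewrite scalerDr scalerA -rmorphM divfK ?gt_eqF // addrAC -scalerDl.
  by rewrite addrC [_ + (1 - _)]addrC subrK scale1r addrC.
apply: unit_ball_convex => //.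
by rewrite divr_ge0 ?(ltW e0) //= ler_pdivrMr // mul1r.
Qed.

Let direction_shrink v w e0 e : ball v -> 0 < e <= e0 ->
  ball (v + inR e0 *: w) -> ball (v - inR e0 *: w) ->
  ball (v + inR e *: w) /\ ball (v - inR e *: w).
Proof.
move=> bv /andP[e_gt0 ee0] bp bm.
have e00 := lt_le_trans e_gt0 ee0.
split; first by apply: (@ball_between v w e e0) => //; rewrite (ltW e_gt0).
rewrite -scalerN; apply: (@ball_between v (- w) e e0) => //; rewrite ?(ltW e_gt0) //.
by rewrite scalerN.
Qed.

Let direction0 v : ball v -> direction v 0.
Proof. by move=> bv; exists 1 => //; rewrite scaler0 addr0 subr0. Qed.

Let directionZ v w a : ball v -> direction v w -> direction v (inR a *: w).
Proof.
move=> bv [e e0 [bp bm]].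
have [->|a0] := eqVneq a 0; first by rewrite rmorph0 scale0r; exact: direction0.
exists (e / `|a|); first by rewrite divr_gt0 // normr_gt0.
rewrite scalerA -rmorphM.
have [ap|an] := ltP 0 a; first by rewrite (gtr0_norm ap) divfK.
rewrite (ler0_norm an) invrN mulrN mulNr divfK // rmorphN scaleNr opprK.
by split.
Qed.

(** For a common step [e], moving by [e / 2] along [w1 + w2] reaches the midpoint of the two moves
    by [e] along [w1] and [w2]. *)
Let directionD v w1 w2 : ball v -> direction v w1 -> direction v w2 ->
  direction v (w1 + w2).
Proof.
move=> bv [e1 e1p [p1 m1]] [e2 e2p [p2 m2]].
pose e := Num.min e1 e2.
have e0 : 0 < e by rewrite lt_min e1p e2p.
have {p1 m1}[p1 m1] : ball (v + inR e *: w1) /\ ball (v - inR e *: w1).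
  by apply: (@direction_shrink _ _ e1) => //; rewrite e0 ge_min lexx.
have {p2 m2}[p2 m2] : ball (v + inR e *: w2) /\ ball (v - inR e *: w2).
  by apply: (@direction_shrink _ _ e2) => //; rewrite e0 ge_min lexx orbT.
have half (u u' : W) : ball u -> ball u' -> ball (inR 2^-1 *: (u + u')).
  move=> bu bu'; have := @unit_ball_convex u u' 2^-1.
  have -> : 1 - inR 2^-1 = inR 2^-1.
    by rewrite -(rmorph1 inR) -rmorphB; congr (inR _); lra.
  by rewrite scalerDr; apply => //; rewrite invr_ge0 ler0n /= invf_le1 ?ler1n.
exists (e / 2); first by rewrite divr_gt0.
have twice : v = inR 2^-1 *: (v + v).
  rewrite -(mulr2n v) -(scaler_nat 2 v) scalerA -(rmorph_nat inR) -rmorphM.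
  by rewrite mulVf // rmorph1 scale1r.
have -> : inR (e / 2) *: (w1 + w2) = inR 2^-1 *: (inR e *: w1 + inR e *: w2).
  by rewrite -scalerDr scalerA -rmorphM mulrC.
split.
- by rewrite {1}twice -scalerDr addrACA; exact: half.
- by rewrite {1}twice -scalerBr opprD addrACA; exact: half.
Qed.

(** The homothety of centre [u'] and ratio [t] sends [u] to [v], preserves the ball and scales the
    moves along [w] by [t]. *)
Let direction_segment u u' v w (t : R) : 0 < t < 1 -> ball u' ->
  v = inR t *: u + (1 - inR t) *: u' -> direction u w -> direction v w.
Proof.
move=> /andP[t0 t1] bu' -> [e e0 [bp bm]].
exists (t * e); first by rewrite mulr_gt0.
rewrite rmorphM -scalerA ![_ + (1 - _) *: u']addrC -!addrA -scalerDr -scalerBr.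
rewrite ![(1 - _) *: u' + _]addrC.
by split; apply: unit_ball_convex => //; rewrite !ltW.
Qed.

Let ray_end (v w : W) : ball v -> w != 0 ->
  exists2 s : R, 0 <= s & ball (v + inR s *: w) /\
    forall e, 0 <= e -> ball (v + inR e *: w) -> e <= s.
Proof.
move=> bv w0.
have Nw : 0 < re (N w).
  rewrite lt0r re_ge0 ?is_norm_ge0 // andbT; apply/eqP => Nw0.
  move/eqP: w0; apply; apply: (is_norm_eq0 Nnorm).
  by rewrite -[LHS](inR_re S (is_norm_ge0 Nnorm _)) Nw0 rmorph0.
have reN u : ball u = (re (N u) <= 1) :> Prop.
  by rewrite -(re1 S) (le_re_le S (is_norm_ge0 Nnorm _) ler01).
pose f (s : R) := re (N (v + inR s *: w)).
have cf : continuous f.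
  have := @continuous_norm_comb _ _ _ S _ N Nnorm R bool
    (fun b s => if b then s else 1) (fun b => if b then w else v).
  have -> : (fun s => re (N (\sum_i inR (if i then s else 1) *: (if i then w else v)))) = f.
    by apply/funext => s; rewrite big_bool /= rmorph1 scale1r addrC.
  by apply => -[] s; [exact: cvg_id|exact: cvg_cst].
(* If both [v] and [v + s w] are in the ball, then [s N(w) <= 2], so the admissible [s] stay in a
   compact interval. *)
pose A := `[0, 2 / re (N w)]%classic `&` [set s | f s <= 1].
have cA : compact A by apply: compact_closedI; [exact: segment_compact|exact: closed_sublevel].
have inA s : 0 <= s -> ball (v + inR s *: w) -> A s.
  move=> s0; rewrite reN => bs; split => //=; rewrite in_itv /= s0 ler_pdivlMr //.
  have -> : s * re (N w) = re (N (inR s *: w)).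
    by rewrite (is_normZ Nnorm) norm_inR re_inRM ger0_norm.
  rewrite -[inR s *: w](addKr v) addrC.
  rewrite (le_trans (re_le S (is_normD Nnorm _ _))) // raddfD /= -scaleN1r.
  rewrite (is_normZ Nnorm) normrN1 mul1r -[X in _ <= X]/(1 + 1) lerD //.
  by rewrite -reN.
have cid : continuous (fun x : R => x) by move=> x; exact: cvg_id.
have A0 : A 0 by apply: inA => //; rewrite rmorph0 scale0r addr0.
have [s [/= +] fs maxs] := compact_argmax (ex_intro _ _ A0) cA cid.
rewrite in_itv /= => /andP[s0 _]; exists s => //; split; first by rewrite reN.
by move=> e e0 /(inA _ e0); exact: maxs.
Qed.

Let not_extreme_direction v : ball v -> ~ extreme_points ball v ->
  exists2 w, w != 0 & direction v w.
Proof.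
move=> bv /not_andP[//|/existsNP[a /existsNP[b /existsNP[t]]]].
move=> /not_implyP[ba /not_implyP[bb /not_implyP[/andP[t0 t1] /not_implyP[vE abv]]]].
(* The weight [t] ranges over [K], but [0 < t] already makes it real. *)
have tE := inR_re S (ltW t0); set s := re t in tE.
have s0 : 0 < s by rewrite -(inR_lt S) rmorph0 tE.
have s1 : s < 1 by rewrite -(inR_lt S) rmorph1 tE.
exists (a - b).
  rewrite subr_eq0; apply/eqP => ab; apply: abv; move: vE.
  by rewrite ab -scalerDl addrC subrK scale1r => ->.
(* Moving along [a - b] by [e] either way keeps the weight of [a] between 0 and 1. *)
pose e := Num.min s (1 - s).
have e0 : 0 < e by rewrite lt_min s0 subr_gt0.
have es : e <= s by rewrite ge_min lexx.
have es1 : e <= 1 - s by rewrite ge_min lexx orbT.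
exists e => //; rewrite vE -tE.
have shift (x : R) : inR s *: a + (1 - inR s) *: b + inR x *: (a - b) =
    inR (s + x) *: a + (1 - inR (s + x)) *: b.
  rewrite rmorphD opprD addrA scalerBr addrACA -scalerDl -scaleNr -[in RHS]addrA.
  by rewrite -[in LHS]scalerDl addrA.
split; first by rewrite shift; apply: unit_ball_convex => //; lra.
rewrite -(scaleNr (inR e)) -(rmorphN inR e) shift; apply: unit_ball_convex => //; lra.
Qed.

Let opposite_ends (u w : W) (s s' : R) : 0 < s -> 0 < s' ->
  u = inR (s' / (s + s')) *: (u + inR s *: w) +
      (1 - inR (s' / (s + s'))) *: (u + inR s' *: - w).
Proof.
move=> s0 s'0; have ss' : s + s' != 0 by rewrite gt_eqF // addr_gt0.
rewrite !scalerDr addrACA -scalerDl addrC [_ + (1 - _)]addrC subrK scale1r.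
rewrite scalerN scalerN !scalerA -scalerBl -(rmorph1 inR) -rmorphB -!rmorphM -rmorphB.
have -> : s' / (s + s') * s - (1 - s' / (s + s')) * s' = 0 by field.
by rewrite rmorph0 scale0r add0r.
Qed.

(* Minkowski's theorem, by induction on the dimension of the space of directions
   in which one can move both ways: a point which is not extreme lies inside a
   segment whose ends have strictly fewer such directions. *)
Lemma extreme_points_generate (C : set W) :
  (forall (a b : W) (t : R), 0 < t < 1 -> C a -> C b ->
    C (inR t *: a + (1 - inR t) *: b)) ->
  extreme_points ball `<=` C -> ball `<=` C.
Proof.
move=> Cconv extC v bv.
have [E [_ Espan _]] := real_span S {: W}.
pose vec (r : 'rV[R]_(\dim {:W} * d)) := \sum_k inR (r 0 k) *: E k.
have vecP w : exists r, vec r = w.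
  by have [r ->] := Espan w (memvf _); exists r.
have vec_lin a r r' : vec (a *: r + r') = inR a *: vec r + vec r'.
  rewrite scaler_sumr -big_split; apply: eq_bigr => k _ /=.
  by rewrite !mxE rmorphD rmorphM scalerDl scalerA.
(* [U] is only required to contain the coordinates of the directions at [u], so the induction can
   start from the full space. *)
suff main k (U : {vspace 'rV[R]_(\dim {:W} * d)}) u : (\dim U <= k)%N -> ball u ->
    (forall r, direction u (vec r) -> r \in U) -> C u.
  by apply: (main _ fullv) => // r _; exact: memvf.
elim: k U u => [|k IH] U u.
  rewrite leqn0 dimv_eq0 => /eqP-> bu dirU.
  apply: extC; apply: contrapT => /(not_extreme_direction bu)[w w0 dw].
  have [r rw] := vecP w; move: dw; rewrite -rw => /dirU; rewrite memv0 => /eqP r0.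
  have := vec_lin (-1) 0 0; rewrite addr0 scaler0 rmorphN1 scaleN1r addNr => vec0.
  by move/eqP: w0; apply; rewrite -rw r0.
move=> dimU bu dirU; have [/extC //|/(not_extreme_direction bu)[w w0 dw]] :=
  pselect (extreme_points ball u).
have Nw0 : - w != 0 by rewrite oppr_eq0.
have [s s0 [bs maxs]] := ray_end bu w0.
have [s' s'0 [bs' maxs']] := ray_end bu Nw0.
have [e e0 [bp bm]] := dw.
have es : e <= s by apply: maxs => //; exact: ltW.
have es' : e <= s' by apply: maxs'; [exact: ltW|rewrite scalerN].
have sp := lt_le_trans e0 es; have s'p := lt_le_trans e0 es'.
pose p := u + inR s *: w; pose q := u + inR s' *: - w.
(* The directions at such an [x] form a subspace of [U] that misses [w], hence one of smaller
   dimension. *)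
have lower x : ball x -> (forall y, direction x y -> direction u y) ->
    ~ direction x w -> C x.
  move=> bx xu xw.
  have [||U' U'P] := @vspace_of_closed _ _ (fun r => direction x (vec r)).
  - have := vec_lin (-1) 0 0; rewrite addr0 scaler0 rmorphN1 scaleN1r addNr => ->.
    exact: direction0.
  - by move=> a r r' dr dr'; rewrite vec_lin; apply: directionD => //; exact: directionZ.
  apply: (IH U') => //; last by move=> r /U'P.
  have [r rw] := vecP w.
  have U'U : (U' <= U)%VS by apply/subvP => r' /U'P/xu/dirU.
  have := dimvS U'U; rewrite leq_eqVlt => /orP[|lt]; last first.
    by rewrite -ltnS (leq_trans lt).
  move=> dimE; case: xw; rewrite -rw; apply/U'P.
  have /eqP -> : U' == U by rewrite eqEdim U'U (eqP dimE) /=.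
  by apply: dirU; rewrite rw.
have uE := opposite_ends u w sp s'p.
have uE' := opposite_ends u (- w) s'p sp; rewrite opprK in uE'.
have th (x y : R) : 0 < x -> 0 < y -> 0 < y / (x + y) < 1.
  move=> x0 y0; have xy := addr_gt0 x0 y0.
  by rewrite divr_gt0 //= ltr_pdivrMr // mul1r ltrDr.
(* Were [w] a direction at [p], the ray from [u] would stay in the ball beyond the maximal [s]. *)
have Cp : C p.
  apply: lower => // [y|[x x0 [bx _]]].
    exact: (direction_segment (th _ _ sp s'p) bs' uE).
  have : s + x <= s.
    by apply: maxs; [rewrite addr_ge0 // ltW|rewrite rmorphD scalerDl addrA].
  by rewrite gerDl leNgt x0.
have Cq : C q.
  apply: lower => // [y|[x x0 [_ bx]]].
    exact: (direction_segment (th _ _ s'p sp) bs uE').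
  have : s' + x <= s'.
    apply: maxs'; first by rewrite addr_ge0 // ltW.
    by rewrite rmorphD scalerDl addrA [inR x *: - w]scalerN.
  by rewrite gerDl leNgt x0.
by rewrite uE; apply: Cconv => //; exact: th.
Qed.

End Minkowski.

(** * Numerical radius and states *)

(** The order of [K] may be partial, as on the complex numbers, but least upper bounds are unique,
    so a maximum determines [supremum]. *)
Lemma supremum_max (K : numFieldType) (A : set K) (m : K) :
  A m -> ubound A m -> supremum 0 A = m.
Proof.
move=> Am ubm; rewrite /supremum; case: ifPn => [/eqP A0|_].
  by move: Am; rewrite A0.
have supm : supremums A m by split => // y; exact.
by case: xgetP => [y _ supy|/(_ m)//]; exact: is_subset1_supremums supy supm.
Qed.

Section NumericalRange.
Context {R : realType} {K : numFieldType} {d : nat} (S : real_form R K d).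
Context {X : finDimBanachType K}.
Notation inR := (inR S).
Notation re := (re S).
Implicit Types (f : 'Hom(X, K^o)) (x : X) (A : 'End(X)).

Lemma norm_is_norm : is_norm (fun x : X => `|x|).
Proof.
split; [exact: normr_ge0|exact: normr0_eq0|exact: normrZ|exact: ler_normD].
Qed.

Lemma scalar_norm_is_norm : is_norm (fun z : K^o => `|z : K|).
Proof.
split; [exact: normr_ge0|exact: normr0_eq0|exact: normrM|exact: ler_normD].
Qed.

(** In real coordinates the unit ball is compact and [f] continuous, so the supremum defining the
    dual norm is attained. *)
Lemma dual_norm_max f : exists2 x, `|x| <= 1 & dual_norm f = `|f x : K| /\
  forall y, `|y| <= 1 -> `|f y : K| <= dual_norm f.
Proof.
have [E [_ Espan Efree]] := real_span S {: X}.
pose vec (r : 'rV[R]_(\dim {:X} * d)) := \sum_k inR (r 0 k) *: E k.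
have cball := unit_ball_compact norm_is_norm Efree.
have fE r : f (vec r) = \sum_k inR (r 0 k) *: (f (E k) : K^o).
  by rewrite linear_sum; apply: eq_bigr => k _; rewrite linearZ.
have cf : continuous (fun r => re `|f (vec r) : K|).
  rewrite (_ : (fun r => re `|f (vec r) : K|) =
    fun r : 'rV[R]_(\dim {:X} * d) => re `|(\sum_k inR (r 0 k) *: (f (E k) : K^o)) : K|).
    apply: (@continuous_norm_comb _ _ _ S _ _ scalar_norm_is_norm
      'rV[R]_(\dim {:X} * d) _ (fun k r => r 0 k) (fun k => f (E k))) => k.
    exact: coord_continuous.
  by apply/funext => r; rewrite fE.
have ball0 : [set r : 'rV[R]_(\dim {:X} * d) | `|\sum_k inR (r 0 k) *: E k| <= 1] !=set0.
  by exists 0 => /=; rewrite big1 ?normr0 // => k _; rewrite mxE rmorph0 scale0r.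
have [r br maxr] := compact_argmax ball0 cball cf.
have le_max y : `|y| <= 1 -> `|f y : K| <= `|f (vec r) : K|.
  have [ry ->] := Espan y (memvf _) => by1.
  by rewrite -(le_re_le S) //; exact: maxr.
have dualE : dual_norm f = `|f (vec r) : K|.
  apply: supremum_max; first by exists (vec r).
  by move=> _ [y y1 <-]; exact: le_max.
by exists (vec r) => //; split => // y y1; rewrite dualE; exact: le_max.
Qed.

Lemma dual_norm_ge0 f : 0 <= dual_norm f.
Proof. by have [x _ [-> _]] := dual_norm_max f. Qed.

Lemma dual_norm_apply f x : `|f x : K| <= dual_norm f * `|x|.
Proof.
have [->|x0] := eqVneq x 0; first by rewrite linear0 !normr0 mulr0.
have [_ _ [_ /(_ (`|x|^-1 *: x))]] := dual_norm_max f.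
rewrite normrZ normfV normr_id mulVf ?normr_eq0 // => /(_ (lexx _)).
rewrite linearZ /= normrM normfV normr_id mulrC ler_pdivrMr //.
by rewrite normr_gt0.
Qed.

Lemma dual_norm_is_norm : is_norm (@dual_norm K X).
Proof.
split.
- exact: dual_norm_ge0.
- move=> f f0; apply/lfunP => x; rewrite lfunE /=; apply/eqP.
  by rewrite -normr_le0 (le_trans (dual_norm_apply f x)) // f0 mul0r.
- move=> a f; have [x x1 [fx maxf]] := dual_norm_max f.
  apply: supremum_max; first by exists x; rewrite // scale_lfunE /= normrM fx.
  by move=> _ [y y1 <-]; rewrite scale_lfunE /= normrM ler_wpM2l //; exact: maxf.
- move=> f g; have [x x1 [-> _]] := dual_norm_max (f + g).
  rewrite add_lfunE (le_trans (ler_normD _ _)) //.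
  have [_ _ [_ maxf]] := dual_norm_max f; have [_ _ [_ maxg]] := dual_norm_max g.
  by rewrite lerD //; [exact: maxf|exact: maxg].
Qed.

(** Inequalities suit convexity arguments on the unit balls; the third condition forces both norms
    to equal 1. *)
Definition state f x := [/\ dual_norm f <= 1, `|x| <= 1 & `|f x : K| = 1].

Lemma state_ge1 f x : dual_norm f <= 1 -> `|x| <= 1 -> 1 <= `|f x : K| -> state f x.
Proof.
move=> f1 x1 fx1; split => //; apply/le_anti; rewrite fx1 andbT.
by rewrite (le_trans (dual_norm_apply f x)) // mulr_ile1 // dual_norm_ge0.
Qed.

Lemma state_norm f x : state f x -> dual_norm f = 1 /\ `|x| = 1.
Proof.
move=> [f1 x1 fx1]; have := dual_norm_apply f x; rewrite fx1 => le1.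
split; apply/le_anti; rewrite ?f1 ?x1 /= (le_trans le1) //.
- by rewrite ler_piMr // dual_norm_ge0.
- by rewrite ler_piMl.
Qed.

Lemma stateZ c f x : `|c| = 1 -> state f x -> state (c *: f) x.
Proof.
move=> c1 [f1 x1 fx1]; split => //.
- by rewrite (is_normZ dual_norm_is_norm) c1 mul1r.
- by rewrite scale_lfunE /= normrM c1 mul1r.
Qed.

Section Coordinates.
Context {D1 D2 : nat} (E1 : 'I_D1 -> 'Hom(X, K^o)) (E2 : 'I_D2 -> X).
Hypotheses
  (E1_free : forall r : 'rV[R]_D1, \sum_k inR (r 0 k) *: E1 k = 0 -> r = 0)
  (E2_free : forall r : 'rV[R]_D2, \sum_k inR (r 0 k) *: E2 k = 0 -> r = 0).

Let fvec (p : 'rV[R]_D1 * 'rV[R]_D2) : 'Hom(X, K^o) := \sum_k inR (p.1 0 k) *: E1 k.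
Let xvec (p : 'rV[R]_D1 * 'rV[R]_D2) : X := \sum_k inR (p.2 0 k) *: E2 k.

Lemma pairing_coord A p : fvec p (A (xvec p)) =
  \sum_(k : 'I_D1 * 'I_D2) inR (p.1 0 k.1 * p.2 0 k.2) *: (E1 k.1 (A (E2 k.2)) : K^o).
Proof.
have AZ a x : A (a *: x) = a *: A x by rewrite linearZ.
have EZ i a x : E1 i (a *: x) = a *: (E1 i x : K^o) by rewrite linearZ.
rewrite -(pair_bigA _ (fun i j => inR (p.1 0 i * p.2 0 j) *: (E1 i (A (E2 j)) : K^o))) /=.
rewrite sum_lfunE; apply: eq_bigr => i _; rewrite scale_lfunE /xvec !linear_sum.
by apply: eq_bigr => j _; rewrite /= AZ EZ rmorphM scalerA.
Qed.

Let coord_pair_continuous (k : 'I_D1 * 'I_D2) :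
  continuous (fun p : 'rV[R]_D1 * 'rV[R]_D2 => p.1 0 k.1 * p.2 0 k.2).
Proof.
apply: continuous_mulr => p.
  apply: (@continuous_comp _ _ _ fst (fun r : 'rV[R]_D1 => r 0 k.1)).
    exact: cvg_fst.
  exact: coord_continuous.
apply: (@continuous_comp _ _ _ snd (fun r : 'rV[R]_D2 => r 0 k.2)).
  exact: cvg_snd.
exact: coord_continuous.
Qed.

Lemma pairing_norm_continuous A :
  continuous (fun p => re `|fvec p (A (xvec p)) : K|).
Proof.
rewrite (_ : (fun p => re `|fvec p (A (xvec p)) : K|) = fun p => re `|(\sum_(k : 'I_D1 * 'I_D2)
    inR (p.1 0 k.1 * p.2 0 k.2) *: (E1 k.1 (A (E2 k.2)) : K^o)) : K|).
  exact: (@continuous_norm_comb _ _ _ S _ _ scalar_norm_is_norm _ _ _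
    (fun k => E1 k.1 (A (E2 k.2))) coord_pair_continuous).
by apply/funext => p; rewrite pairing_coord.
Qed.

Lemma pairing_re_continuous A : continuous (fun p => re (fvec p (A (xvec p)))).
Proof.
have -> : (fun p => re (fvec p (A (xvec p)))) = fun p =>
    \sum_(k : 'I_D1 * 'I_D2) (p.1 0 k.1 * p.2 0 k.2) * re (E1 k.1 (A (E2 k.2))).
  apply/funext => p; rewrite pairing_coord raddf_sum.
  by apply: eq_bigr => k _; rewrite /= re_inRM.
apply: continuous_sumr => k; apply: continuous_mulr; first exact: coord_pair_continuous.
exact: cst_continuous.
Qed.

Lemma states_compact : compact [set p | state (fvec p) (xvec p)].
Proof.
have -> : [set p | state (fvec p) (xvec p)] =
    ([set r : 'rV[R]_D1 | dual_norm (\sum_k inR (r 0 k) *: E1 k) <= 1] `*`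
     [set r : 'rV[R]_D2 | `|\sum_k inR (r 0 k) *: E2 k| <= 1]) `&`
    [set p | 1 <= re `|fvec p (xvec p) : K|].
  apply/seteqP; split => p /=; first by move=> [f1 x1 ->]; rewrite re1.
  move=> [[f1 x1] fx]; apply: state_ge1 => //.
  by rewrite -(le_re_le S) ?ler01 ?re1.
apply: compact_closedI.
  apply: compact_setX.
    exact: (unit_ball_compact dual_norm_is_norm E1_free).
  exact: (unit_ball_compact norm_is_norm E2_free).
apply: closed_suplevel.
(* Inserting the identity operator makes this an instance of [pairing_norm_continuous]. *)
rewrite (_ : (fun p => re `|fvec p (xvec p) : K|) =
  fun p => re `|fvec p (\1%VF (xvec p)) : K|).
  exact: pairing_norm_continuous.
by apply/funext => p; rewrite id_lfunE.
Qed.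

End Coordinates.

End NumericalRange.

(** * Attaining states and orthogonality *)

Section Orthogonality.
Context {R : realType} {K : numFieldType} {d : nat} (S : real_form R K d).
Context {X : finDimBanachType K}.
Hypotheses (X_nontrivial : (0 < \dim {:X})%N)
  (w_norm : is_norm (numerical_radius (X := X))).
Notation inR := (inR S).
Notation re := (re S).
Notation w := (numerical_radius (X := X)).
Implicit Types (f : 'Hom(X, K^o)) (x : X) (A T : 'End(X)).

(** Hides the real coordinates: the arguments below use only compactness, continuity and
    surjectivity of the parametrization. *)
Lemma states_parametrized : exists (U : topologicalType)
    (F : U -> 'Hom(X, K^o)) (Y : U -> X),
  [/\ compact [set p | state (F p) (Y p)],
      forall A, continuous (fun p => re (F p (A (Y p))))
    & forall f x, exists p, F p = f /\ Y p = x].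
Proof.
have [E1 [_ span1 free1]] := real_span S {: 'Hom(X, K^o)}.
have [E2 [_ span2 free2]] := real_span S {: X}.
exists ('rV[R]_(\dim {: 'Hom(X, K^o)} * d) * 'rV[R]_(\dim {: X} * d))%type.
exists (fun p => \sum_k inR ((p.1 : 'rV_(_)) 0 k) *: E1 k).
exists (fun p => \sum_k inR ((p.2 : 'rV_(_)) 0 k) *: E2 k).
split; first exact: states_compact.
  by move=> A; exact: pairing_re_continuous.
move=> f x; have [r1 ->] := span1 f (memvf f); have [r2 ->] := span2 x (memvf x).
by exists (r1, r2).
Qed.

(* If no pair defines the numerical radius then it vanishes identically, hence
   cannot be a norm. *)
Lemma state_exists : exists f x, state f x.
Proof.
apply: contrapT => noState.
have w0 : w \1%VF = 0.
  rewrite /numerical_radius (_ : [set _ | _] = set0) ?supremum0 //.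
  apply/seteqP; split => // r [f [x [f1 x1 fx _]]]; apply: noState; exists f, x.
  by rewrite /state f1 x1 fx normr1.
have : \1%VF = 0 :> 'End(X) by apply: (is_norm_eq0 w_norm).
move=> /lfunP one0; move: X_nontrivial; rewrite lt0n dimv_eq0 => /eqP; apply.
apply/eqP; rewrite -subv0; apply/subvP => x _; rewrite memv0.
by have := one0 x; rewrite id_lfunE zero_lfunE => ->.
Qed.

(** Maximize [re (f (A x))] over the compact set of states. Multiplying [f] by a unit scalar
    preserves states, so the maximum also bounds every modulus and is itself a modulus. *)
Lemma numerical_radius_max A : exists f x, [/\ state f x, f (A x) = w A
  & forall g y, state g y -> `|g (A y) : K| <= w A].
Proof.
have [U [F [Y [cP cre surj]]]] := states_parametrized.
have P0 : [set p | state (F p) (Y p)] !=set0.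
  have [f [x fx]] := state_exists; have [p [Fp Yp]] := surj f x.
  by exists p; rewrite /= Fp Yp.
have [p /= sp maxp] := compact_argmax P0 cP (cre A).
have le_max g y : state g y -> re `|g (A y) : K| <= re (F p (A (Y p))).
  move=> gy; have [c c1 cg] := phase (g (A y) : K).
  have [q [Fq Yq]] := surj (c *: g) y.
  have := maxp q; rewrite /= Fq Yq scale_lfunE /= => /(_ (stateZ S c1 gy)).
  by rewrite -[c *: _]/(c * _) cg.
have pE : F p (A (Y p)) = `|F p (A (Y p)) : K| :> K.
  by apply: (@re_eq_norm _ _ _ S); apply/le_anti; rewrite (re_le_norm S) le_max.
have {}le_max g y : state g y -> `|g (A y) : K| <= `|F p (A (Y p)) : K|.
  by move=> gy; rewrite -(le_re_le S) //; rewrite -pE; exact: le_max.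
suff wE : w A = `|F p (A (Y p)) : K|.
  by exists (F p), (Y p); split => //; rewrite wE.
apply: supremum_max; last first.
  move=> _ [g [y [g1 y1 gy ->]]]; apply: le_max.
  by rewrite /state g1 y1 gy normr1.
(* The numerical radius asks for [f x = 1] while a state only has modulus 1: divide the functional
   by its value [z]. *)
have [_ _ sp1] := sp; set z := F p (Y p) : K in sp1.
have z0 : z != 0 by rewrite -normr_gt0 sp1.
have zV1 : `|z^-1| = 1 by rewrite normfV sp1 invr1.
have [n1 n2] := state_norm S (stateZ S zV1 sp).
exists (z^-1 *: F p), (Y p); split => //.
  by rewrite scale_lfunE /= -[_ *: _]/(_ * _) mulVf.
by rewrite scale_lfunE /= normrM zV1 mul1r.
Qed.

Lemma numerical_radius_ge f x A : state f x -> `|f (A x) : K| <= w A.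
Proof. by have [g [y [_ _ maxw]]] := numerical_radius_max A; exact: maxw. Qed.

Definition attaining T f x := state f x /\ f (T x) = w T.

(** Equality must hold throughout [re z <= |z| <= w T] for [z = f (T x)], so [z] is real and equal
    to [w T]. Attainment thus becomes a closed condition on real parts. *)
Lemma attaining_re T f x : state f x -> re (w T) <= re (f (T x)) -> attaining T f x.
Proof.
move=> fx wfx; split => //.
have w0 : 0 <= w T := is_norm_ge0 w_norm T.
have le1 := re_le S (numerical_radius_ge T fx).
have fE : f (T x) = `|f (T x) : K| :> K.
  by apply: (@re_eq_norm _ _ _ S); apply/le_anti; rewrite (re_le_norm S) (le_trans le1).
apply/le_anti; rewrite fE numerical_radius_ge //=.
by rewrite -(le_re_le S) // -fE.
Qed.

Lemma mean_max (m x y t : R) : 0 < t < 1 -> x <= m -> y <= m ->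
  m <= t * x + (1 - t) * y -> m <= x /\ m <= y.
Proof. by move=> /andP[t0 t1] xm ym mxy; split; nra. Qed.

(** A mean that reaches the common upper bound of its terms forces each term to reach it; this is
    applied to the bound 1 and then to [w T]. Two pairs are allowed so as to cover both a segment in
    [X] and one in the dual. *)
Lemma attaining_segment T f x f1 x1 f2 x2 (t : R) : 0 < t < 1 ->
  dual_norm f1 <= 1 -> `|x1| <= 1 -> dual_norm f2 <= 1 -> `|x2| <= 1 ->
  f x = inR t * f1 x1 + (1 - inR t) * f2 x2 :> K ->
  f (T x) = inR t * f1 (T x1) + (1 - inR t) * f2 (T x2) :> K ->
  attaining T f x -> attaining T f1 x1 /\ attaining T f2 x2.
Proof.
move=> t01 f1n x1n f2n x2n fxE fTxE [[_ _ fx1] fTx].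
have /andP[/ltW t0 /ltW t1] := t01.
have tE : 1 - inR t = inR (1 - t) by rewrite rmorphB rmorph1.
have t1' : 0 <= 1 - t by rewrite subr_ge0.
have bound (g : 'Hom(X, K^o)) (y : X) : dual_norm g <= 1 -> `|y| <= 1 -> `|g y : K| <= 1.
  move=> g1 y1; rewrite (le_trans (dual_norm_apply S g y)) //.
  by rewrite mulr_ile1 // (dual_norm_ge0 S).
have re_bound (g : 'Hom(X, K^o)) (y : X) : dual_norm g <= 1 -> `|y| <= 1 -> re `|g y : K| <= 1.
  by move=> g1 y1; rewrite -(re1 S) (re_le S) // bound.
have [s1 s2] : 1 <= re `|f1 x1 : K| /\ 1 <= re `|f2 x2 : K|.
  apply: (mean_max t01); [exact: re_bound|exact: re_bound|].
  rewrite -[leLHS](re1 S) -fx1 fxE -!(re_inRM S) -raddfD /=.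
  apply: (re_le S); rewrite (le_trans (ler_normD _ _)) // !normrM tE !norm_inR.
  by rewrite (ger0_norm t0) (ger0_norm t1').
have st (g : 'Hom(X, K^o)) (y : X) :
    dual_norm g <= 1 -> `|y| <= 1 -> 1 <= re `|g y : K| -> state g y.
  move=> g1 y1 gy; apply: (state_ge1 S) => //.
  by rewrite -(le_re_le S) ?ler01 // re1.
have st1 := st _ _ f1n x1n s1; have st2 := st _ _ f2n x2n s2.
have re_w g y : state g y -> re (g (T y)) <= re (w T).
  move=> gy; rewrite (le_trans (re_le_norm S _)) // (re_le S) //.
  exact: numerical_radius_ge.
have [w1 w2] : re (w T) <= re (f1 (T x1)) /\ re (w T) <= re (f2 (T x2)).
  apply: (mean_max t01); [exact: re_w|exact: re_w|].
  by rewrite -fTx fTxE tE raddfD /= !re_inRM.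
by split; apply: attaining_re.
Qed.

(* Orthogonality is used through small real multiples [T - e S]; compactness of
   the set of states then replaces the limit [e -> 0]. *)
Lemma orth_attaining T A : orth_w T A ->
  exists f x, attaining T f x /\ re (f (A x)) <= 0.
Proof.
move=> TA; have [U [F [Y [cP cre surj]]]] := states_parametrized.
pose h p := re (w T) - re (F p (T (Y p))).
pose g p := re (F p (A (Y p))).
pose P := [set p | state (F p) (Y p)].
have h0 p : P p -> 0 <= h p.
  move=> sp; rewrite subr_ge0 (le_trans (re_le_norm S _)) // (re_le S) //.
  exact: numerical_radius_ge.
have small e : 0 < e -> exists2 p, P p & h p + e * g p <= 0.
  move=> e0; have [f [x [fx fE _]]] := numerical_radius_max (T + inR (- e) *: A).
  have [p [Fp Yp]] := surj f x; exists p; first by rewrite /P /= Fp Yp.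
  have := re_le S (TA (inR (- e))); rewrite -fE add_lfunE scale_lfunE linearD /=.
  rewrite linearZ raddfD /= -[_ *: _]/(_ * _) re_inRM => wle.
  rewrite /h /g Fp Yp; lra.
(* As [h] is nonnegative on states, every state given by [small] lies in [P']. It remains to see
   that the minimum of the gap [h] over this compact set is 0. *)
pose P' := P `&` [set p | g p <= 0].
have smallP' e p : 0 < e -> P p -> h p + e * g p <= 0 -> P' p.
  move=> e0 Pp hg; split => //=; rewrite -(pmulr_rle0 _ e0).
  by rewrite (le_trans _ hg) // lerDr h0.
have cP' : compact P' by apply: compact_closedI => //; apply: closed_sublevel; exact: cre.
have P'0 : P' !=set0.
  by have [p Pp hg] := small 1 ltr01; exists p; exact: (smallP' 1).
have hc : continuous h.
  by move=> p; apply: cvgB; [exact: cvg_cst|exact: cre].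
have [p [/= Pp gp] minp] := compact_argmin P'0 cP' hc.
exists (F p), (Y p); split => //; apply: attaining_re => //.
rewrite -subr_le0 leNgt; apply/negP => hp.
have [q [Pq _] minq] := compact_argmin P'0 cP' (cre A).
pose C := `|g q| + 1.
have C0 : 0 < C by rewrite ltr_pwDr.
(* On [P'] one has [-C <= g] and [h p <= h]. For this [e] the sum [h + e g] is at least
   [h p / 2 > 0] there, contradicting [small]. *)
have e0 : 0 < h p / (2 * C) by rewrite divr_gt0 // mulr_gt0.
have [r Pr hr] := small _ e0.
have P'r := smallP' _ _ e0 Pr hr.
have hpr := minp _ P'r; have gr := minq _ P'r; rewrite -/(g _) -/(g _) in gr.
have Cr : - C <= g r.
  by rewrite (le_trans _ gr) // lerNl (le_trans (ler_norm _)) // normrN lerDl.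
have : h p / (2 * C) * - C <= h p / (2 * C) * g r by rewrite ler_pM2l.
have -> : h p / (2 * C) * - C = - (h p / 2) by field; rewrite gt_eqF.
rewrite -/(h p) in hp; lra.
Qed.

End Orthogonality.

(** * Characterization of orthogonality *)

Lemma convex_sum (R : realFieldType) (V : lmodType R) (C : set V) :
  (forall s u v, 0 <= s <= 1 -> C u -> C v -> C (s *: u + (1 - s) *: v)) ->
  forall (h : nat) (t : 'I_h -> R) (a : 'I_h -> V),
  (forall i, 0 <= t i) -> (forall i, C (a i)) -> \sum_i t i = 1 ->
  C (\sum_i t i *: a i).
Proof.
move=> Cconv; elim=> [|h IH] t a t0 Ca.
  by rewrite big_ord0 => /esym/eqP; rewrite oner_eq0.
rewrite !big_ord_recl => t1.
pose s := \sum_(i < h) t (lift ord0 i).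
have s0 : 0 <= s by apply: sumr_ge0.
have tE : t ord0 = 1 - s by rewrite -t1 addrK.
have [sz|sn0] := eqVneq s 0.
  rewrite [X in _ + X]big1 ?addr0 => [|i _]; first by rewrite tE sz subr0 scale1r.
  have /psumr_eq0P -> // : \sum_(i < h) t (lift ord0 i) = 0 by [].
  by rewrite scale0r.
rewrite addrC tE.
have -> : \sum_(i < h) t (lift ord0 i) *: a (lift ord0 i) =
    s *: \sum_(i < h) (t (lift ord0 i) / s) *: a (lift ord0 i).
  rewrite scaler_sumr; apply: eq_bigr => i _.
  by rewrite scalerA mulrC divfK.
apply: Cconv => //; first by rewrite s0 -subr_ge0 -tE t0.
apply: IH => // [i|]; first by rewrite divr_ge0.
by rewrite -mulr_suml divff.
Qed.

Section Characterization.
Context {R : realType} {K : numFieldType} {d : nat} (S : real_form R K d).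
Context {X : finDimBanachType K}.
Hypotheses (X_nontrivial : (0 < \dim {:X})%N)
  (w_norm : is_norm (numerical_radius (X := X))).
Notation inR := (inR S).
Notation re := (re S).
Notation w := (numerical_radius (X := X)).

Definition extreme_attaining (T : 'End(X)) : set ('Hom(X, K^o) * X) :=
  [set p | [/\ extdual p.1, extX p.2, `|p.1 p.2 : K| = 1 & p.1 (T p.2) = w T]].

(** Minkowski's theorem is applied twice, first to [x] with [f] fixed, then to [f] with [x] already
    extreme. The sets it is applied to are convex because attainment passes to the ends of a
    segment. *)
Lemma attaining_combination (T : 'End(X)) (N : nat) (B : 'I_N -> 'End(X))
    (f : 'Hom(X, K^o)) (x : X) :
  let phi (p : 'Hom(X, K^o) * X) : 'rV[R]_N := \row_j re (p.1 (B j p.2)) in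
  attaining T f x -> combination (extreme_attaining T) phi N.+1 (phi (f, x)).
Proof.
move=> phi.
have conv_range (t : R) : 0 < t < 1 -> 0 <= t <= 1 by move=> /andP[/ltW-> /ltW->].
have phi_row (p p1 p2 : 'Hom(X, K^o) * X) (t : R) :
    (forall A : 'End(X), p.1 (A p.2) =
      inR t * p1.1 (A p1.2) + (1 - inR t) * p2.1 (A p2.2) :> K) ->
    phi p = t *: phi p1 + (1 - t) *: phi p2.
  move=> pE; apply/rowP => j; rewrite !mxE pE raddfD /= re_inRM.
  by rewrite -(rmorph1 inR) -rmorphB re_inRM.
suff Cx : closed_unit_ball (fun y : X => `|y|) `<=`
    [set y | `|y| <= 1 /\ (attaining T f y ->
    combination (extreme_attaining T) phi N.+1 (phi (f, y)))].
  by move=> fx; have [[_ x1 _] _] := fx; have [_] := Cx x x1; apply.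
refine (extreme_points_generate (S := S) norm_is_norm _ _) => /=
  [a b t t01 [a1 Ca] [b1 Cb]|y exty].
  split; first exact: (unit_ball_convex S norm_is_norm (conv_range t t01)).
  move=> fy; have fn : dual_norm f <= 1 by have [[]] := fy.
  have segE (A : 'End(X)) : f (A (inR t *: a + (1 - inR t) *: b)) =
      inR t * f (A a) + (1 - inR t) * f (A b) :> K.
    by rewrite !linearD !linearZ.
  have fE : f (inR t *: a + (1 - inR t) *: b) = inR t * f a + (1 - inR t) * f b :> K.
    by rewrite !linearD !linearZ.
  have [fa fb] := attaining_segment X_nontrivial w_norm t01 fn a1 fn b1 fE (segE T) fy.
  rewrite (phi_row (f, _) (f, a) (f, b) t) //.
  by apply: combination_convex; [exact: conv_range|exact: Ca|exact: Cb].
have y1 : `|y| <= 1 by case: exty.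
split => // fy.
suff Cf : closed_unit_ball (@dual_norm K X) `<=`
    [set g | dual_norm g <= 1 /\ (attaining T g y ->
    combination (extreme_attaining T) phi N.+1 (phi (g, y)))].
  by have [[f1 _ _] _] := fy; have [_] := Cf f f1; apply.
refine (extreme_points_generate (S := S) (dual_norm_is_norm S) _ _) => /=
  [a b t t01 [a1 Ca] [b1 Cb]|g extg].
  split; first exact: (unit_ball_convex S (dual_norm_is_norm S) (conv_range t t01)).
  move=> gy.
  have segE (z : X) : (inR t *: a + (1 - inR t) *: b) z =
      inR t * a z + (1 - inR t) * b z :> K.
    by rewrite add_lfunE !scale_lfunE.
  have [ga gb] := attaining_segment X_nontrivial w_norm t01 a1 y1 b1 y1
    (segE y) (segE (T y)) gy.
  rewrite (phi_row (_, y) (a, y) (b, y) t) //.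
  by apply: combination_convex; [exact: conv_range|exact: Ca|exact: Cb].
split; first by case: extg.
move=> [[_ _ gy1] gTy]; exact: (@combination_point _ _ _ _ phi _ (g, y)).
Qed.

Lemma orth_w_characterization (n : nat) (V : {vspace 'End(X)}) (dimV : \dim V = n)
    (T : 'End(X)) :
  [<-> orth_w_space T V;
       exists (h : nat) (t : 'I_h -> K) (f : 'I_h -> 'Hom(X, K^o)) (x : 'I_h -> X),
         [/\ (h <= (n * d).+1)%N,
             forall i, 0 < t i,
             forall i, [/\ extdual (f i), extX (x i), `|f i (x i) : K| = 1
                         & f i (T (x i)) = w T],
             \sum_i t i = 1
           & forall A, A \in V -> \sum_i t i * f i (A (x i)) = 0];
       forall A, A \in V -> convex_hull (attaining_values T A) 0].
Proof.
tfae.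
- move=> TV; have [B [BV Bspan _]] := real_span S V; rewrite dimV in B BV Bspan *.
  pose phi (p : 'Hom(X, K^o) * X) : 'rV[R]_(n * d) := \row_j re (p.1 (B j p.2)).
  have [U [F [Y [cP cre surj]]]] := states_parametrized S (X := X).
  pose M := [set p | attaining T (F p) (Y p)].
  (* Rewriting attainment as an inequality between real parts exhibits [M] as a closed part of a
     compact set. *)
  have ME : M = [set p | state (F p) (Y p)] `&` [set p | re (w T) <= re (F p (T (Y p)))].
    apply/seteqP; split => p /=; first by move=> [sp ->].
    by move=> [sp wp]; exact: (attaining_re X_nontrivial w_norm sp wp).
  have cM : compact M.
    by rewrite ME; apply: compact_closedI => //; apply: closed_suplevel; exact: cre.
  have sepM A : A \in V -> exists2 p, M p & re (F p (A (Y p))) <= 0.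
    move=> /TV TA; have [f [x [fx fA]]] := orth_attaining S X_nontrivial w_norm TA.
    by have [p [Fp Yp]] := surj f x; exists p; rewrite /M /= Fp Yp.
  have M0 : M !=set0 by have [p Mp _] := sepM 0 (mem0v _); exists p.
  have : combination M (fun p => phi (F p, Y p)) (n * d).+1 0.
    apply: zero_combination => // [j|l].
      rewrite (_ : (fun p => _) = fun p => re (F p (B j (Y p)))) //.
      by apply/funext => p; rewrite mxE.
    (* A linear form [l] on the coordinates is evaluation at this operator of [V], to which
       orthogonality applies. *)
    have lV : \sum_j inR (l 0 j) *: B j \in V by apply: memv_suml => j _; rewrite memvZ.
    have [p Mp lp] := sepM _ lV; exists p => //; move: lp; congr (_ <= 0).
    rewrite sum_lfunE linear_sum raddf_sum; apply: eq_bigr => j _.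
    by rewrite scale_lfunE linearZ /= re_inRM mxE.
  move=> [t [p [t0 Mp t1 tp]]].
  have : combination (extreme_attaining T) phi (n * d).+1 0.
    rewrite -tp; apply: (convex_sum (C := combination _ phi _)) => // [s u v|i].
      exact: combination_convex.
    exact: attaining_combination (Mp i).
  move=> /combination_pos[h [t' [q [hle t'0 Qq t'1 t'q]]]].
  exists h, (inR \o t'), (fun i => (q i).1), (fun i => (q i).2); split => //.
  - by move=> i /=; rewrite -(rmorph0 inR) inR_lt.
  - by rewrite -(rmorph_sum inR) t'1 rmorph1.
  have zero_re A : A \in V -> re (\sum_i inR (t' i) * (q i).1 (A (q i).2)) = 0.
    move=> /Bspan[r ->]; rewrite raddf_sum.
    transitivity (\sum_j r 0 j * (\sum_i t' i *: phi (q i)) 0 j); last first.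
      by rewrite t'q big1 // => j _; rewrite mxE mulr0.
    under [RHS]eq_bigr do rewrite summxE mulr_sumr.
    rewrite exchange_big; apply: eq_bigr => i _ /=; rewrite re_inRM.
    rewrite sum_lfunE linear_sum raddf_sum mulr_sumr; apply: eq_bigr => j _.
    by rewrite scale_lfunE linearZ /= re_inRM !mxE mulrCA.
  (* [V] is stable under scalars of [K], so the real parts also vanish for the multiples of [A] by
     the basis scalars, hence the whole scalar vanishes. *)
  move=> A AV; apply: (@rbasis_separates _ _ _ S) => l.
  rewrite -[RHS](zero_re (rbasis S l *: A)) ?memvZ //; congr (re _).
  rewrite mulr_sumr; apply: eq_bigr => i _.
  by rewrite scale_lfunE linearZ /= mulrCA.
- move=> [h [t [f [x [_ t0 fx t1 tA]]]]] A AV.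
  exists h, t, (fun i => f i (A (x i))); split => //.
  + by move=> i; exact: ltW.
  + by move=> i; have [e1 e2 e3 e4] := fx i; exists (f i), (x i).
  + by rewrite -[LHS](tA A AV).
- move=> hull A AV l; have [m [t [a [t0 aA t1 ta]]]] := hull A AV.
  have w0 B : 0 <= w B := is_norm_ge0 w_norm B.
  (* Each [w T + l * a i] is the value of [T + l *: A] at a state, so its modulus is at most
     [w (T + l *: A)], and so is that of the mean. *)
  have wE : w T = \sum_i t i * (w T + l * a i).
    under eq_bigr do rewrite mulrDr mulrCA.
    rewrite big_split /= -mulr_suml t1 mul1r -mulr_sumr.
    by rewrite -[X in l * X]/(\sum_i t i *: (a i : K^o)) -ta mulr0 addr0.
  rewrite -[leLHS](ger0_norm (w0 T)) [X in `|X|]wE.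
  rewrite (le_trans (ler_norm_sum _ _ _)) //.
  rewrite -[leRHS]mul1r -t1 mulr_suml; apply: ler_sum => i _.
  rewrite normrM ger0_norm // ler_wpM2l //.
  have [f [x [ef ex fx1 <- ->]]] := aA i.
  have fx : state f x by case: ef => ? _; case: ex.
  have := numerical_radius_ge S X_nontrivial w_norm (T + l *: A) fx.
  by rewrite add_lfunE scale_lfunE linearD linearZ.
Qed.

End Characterization.

(** * The real and complex scalar fields *)

Definition real_real_form (R : realType) : real_form R R 1.
Proof.
apply: (@RealForm R R 1 idfun idfun (fun=> 1)) => //=.
- by move=> z; exact: ler_norm.
- by move=> z; exists (fun=> z); rewrite big_ord1 mulr1.
- by move=> r; rewrite big_ord1 mulr1 => r0 l; rewrite ord1.
Defined.

Lemma complex_norm_Re (R : rcfType) (z : R[i]) :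
  complex.Re z = complex.Re `|z| -> z = `|z|.
Proof.
case: z => a b; rewrite normc_def /= => ab.
have ab2 : a ^+ 2 = a ^+ 2 + b ^+ 2.
  by rewrite {1}ab sqr_sqrtr // addr_ge0 ?sqr_ge0.
have /eqP : b ^+ 2 = 0 by apply: (addrI (a ^+ 2)); rewrite addr0 -ab2.
rewrite sqrf_eq0 => /eqP b0.
by rewrite -ab b0.
Qed.

Definition complex_real_form (R : realType) : real_form R R[i] 2.
Proof.
apply: (@RealForm R R[i] 2 (real_complex R) (@complex.Re R)
  (fun l => if l == ord0 then 1 else 'i%C)).
- by move=> a [x y] /=; rewrite mul0r subr0.
- by [].
- by move=> a; rewrite ler0c.
- by move=> [x y] z0; have /= -> := ger0_Im z0.
- move=> z; have := normc_ge_Re z; rewrite lecE /= => /andP[_].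
  by apply: le_trans; exact: ler_norm.
- exact: complex_norm_Re.
- move=> [x y]; exists (fun l => if l == ord0 then x else y).
  rewrite big_ord_recl big_ord1 /=; apply/eqP; rewrite eq_complex /=.
  by rewrite !(mulr0, mulr1, mul0r, addr0, add0r, subr0) !eqxx.
- move=> r; rewrite big_ord_recl big_ord1 /= mulr1 mulrC => r0 l.
  have := congr1 (@complex.Re R) r0; have := congr1 (@complex.Im R) r0.
  rewrite /= !(mul0r, mulr0, mul1r, addr0, add0r, subr0) => im0 re0.
  by case: (unliftP ord0 l) => [j ->|->] //; rewrite ord1.
Defined.

Unset Implicit Arguments.

Theorem theorem3p1 (R : realType) (k : scalar_kind)
    (X : finDimBanachType (scalar_field R k))
    (X_nontrivial : (0 < \dim {:X})%N)
    (w_norm : is_norm (numerical_radius (X := X)))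
    (n : nat) (V : {vspace 'End(X)}) (dimV : \dim V = n) (T : 'End(X)) :
  [<-> orth_w_space T V;
       exists (h : nat) (t : 'I_h -> scalar_field R k)
              (f : 'I_h -> 'Hom(X, (scalar_field R k)^o)) (x : 'I_h -> X),
         [/\ (h <= caratheodory_bound k n)%N,
             forall i, 0 < t i,
             forall i, [/\ extdual (f i), extX (x i),
                           `|f i (x i) : scalar_field R k| = 1
                         & f i (T (x i)) = numerical_radius T],
             \sum_i t i = 1
           & forall S, S \in V -> \sum_i t i * f i (S (x i)) = 0];
       forall S, S \in V -> convex_hull (attaining_values T S) 0].
Proof.
(* With [d = 1] or [d = 2], the bound [(n * d).+1] is the required [n + 1] or [2 * n + 1]. *)
case: k X X_nontrivial w_norm V dimV T => X X_nontrivial w_norm V dimV T.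
  have := orth_w_characterization (real_real_form R) X_nontrivial w_norm dimV T.
  by rewrite muln1 -addn1.
have := orth_w_characterization (complex_real_form R) X_nontrivial w_norm dimV T.
by rewrite [(n * 2)%N]mulnC -addn1.
Qed.
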